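(* Let $d>1$ be a fixed integer, let $\mathcal D$ be the set of all positive integers divisible by $d$, and let $N$ be a positive integer divisible by $d$. Then $$q_N(\mathcal D)=\frac{N}{d(N+1)}\sum_{\substack{dk+d\ell=N\\ k,\ell\ge 0}}\frac{1}{k!\,\ell!}\left(1-(-1)^{dk}\binom{N}{d\ell}^{-1}\right)\prod_{r=1}^{k-1}\left(r-\frac1d\right)\prod_{r'=0}^{\ell-1}\left(r'+\frac1d\right).$$
   Context: For a set $B$ of positive integers, $q_N(B)$ denotes the probability that the product of two independent permutations, each uniformly distributed on the set of all $N$-cycles of the symmetric group $S_N$ on $\{1,\dots,N\}$, has all of its cycle lengths in $B$ (fixed points counted as cycles of length $1$). The sum is over integers $k,\ell$; products over an empty index range (including $\prod_{r=1}^{k-1}$ for $k=0,1$) equal $1$. *)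

(* Defs.v *)
From mathcomp Require Import all_boot all_order all_algebra all_fingroup.

Set Implicit Arguments.
Unset Strict Implicit.
Unset Printing Implicit Defensive.

Import GRing.Theory.
Local Open Scope ring_scope.

(* The symmetric group S_N is 'S_N, acting on 'I_N = {0, ..., N - 1} rather
   than {1, ..., N}. [porbits s] is the set of supports of the cycles of [s],
   fixed points included, so cycle lengths are the cardinals of its members.
   An N-cycle has the whole of 'I_N as its only cycle. *)
Definition long_cycles (N : nat) : {set 'S_N} :=
  [set s | porbits s == [set [set: 'I_N]]].

Definition cycle_lengths_in (N : nat) (B : pred nat) (s : 'S_N) : bool :=
  [forall C in porbits s, #|C| \in B].

(* Two independent uniform N-cycles form a uniform pair in the square of
   [long_cycles N]. *)
Definition q (N : nat) (B : pred nat) : rat :=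
  #|[set st in setX (long_cycles N) (long_cycles N)
     | cycle_lengths_in B (st.1 * st.2)%g]|%:R
  / #|setX (long_cycles N) (long_cycles N)|%:R.

Definition pos_multiples (d : nat) : pred nat :=
  [pred m | (0 < m)%N && (d %| m)%N].

(* Main.v *)
Require Import Defs.
From mathcomp Require Import all_boot all_order all_algebra all_fingroup.
From mathcomp Require Import ring lra zify.

Set Implicit Arguments.
Unset Strict Implicit.
Unset Printing Implicit Defensive.

Import GRing.Theory Num.Theory.
Local Open Scope ring_scope.

(** The number of pairs (a, b) of N-cycles with ab in a prescribed class is
    usually read off from the hook characters of the symmetric group.  Here
    those characters are replaced by signed counts of stable subsets.

    Fix a point p.  A permutation w is an N-cycle exactly when
      sum over the w-stable S not containing p of (-1)^|S| sgn(w|S)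
    equals 1, and the sum is 0 otherwise, because toggling a cycle of w away
    from p reverses the sign ([sum_stable_subsets]).  Apply this to
    b = a^-1 g, where g = ab.  A set S is stable under a^-1 g exactly when S
    has the same preimage under a and under g.  If two or more points of S
    leave S under g, conjugating a by the transposition of two of them
    preserves the N-cycles and reverses the sign, so the contribution of S
    vanishes ([cancel_two_exits]).  If no point leaves, S is stable under the
    N-cycle a and hence empty.  In the remaining case a single s in S leaves
    and a single t outside S enters, and composing a and g with the
    transposition (s t) makes both of them stabilize S
    ([localize_exit_entry]).  The sum then factors into sums over permutations
    of S and of its complement in which every cycle not through a marked point
    has length divisible by d ([sum_stable_merge]); divisibility of the length
    of the merged cycle is automatic since d divides N.

    The resulting rooted sums satisfy a first-order recursion, obtained by
    cutting the root out of its cycle, and so are products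
    ([rooted_sumE]).  This yields the count as a single sum of products of
    factorials and of coefficients of (1 - z)^(+-1/d - 1)
    ([cycle_pair_count], [rooted_prod_bsum]).  That sum is evaluated by
    splitting it into blocks of length d, in each of which an alternating sum
    of the numbers i! (N - 1 - i)! telescopes, followed by a summation by
    parts ([rooted_prod_total]).  The term 1 in the factor
    1 - (-1)^(dk) / C(N, dl) comes from adding a multiple of the
    coefficient of z^(N/d) in (1 - z)^(1/d) (1 - z)^(-1/d) = 1, which is zero
    ([sum_bcoef_cross]). *)

(** * Cycles cut and glued by a transposition *)

Lemma norm_setP (T : finType) (S : {set T}) (w : {perm T}) :
  reflect (forall x, (w x \in S) = (x \in S)) (w \in 'N(S | 'P)%g).
Proof. exact: (iffP astabsP). Qed.

Lemma porbit_sub (T : finType) (A : {set T}) (w : {perm T}) x :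
  {in A, forall z, w z \in A} -> x \in A -> porbit w x \subset A.
Proof.
move=> Aw Ax; apply/subsetP=> y /porbitP[i ->].
elim: i => [|i IHi]; first by rewrite perm1.
by rewrite expgSr permM Aw.
Qed.

Lemma porbit_step (T : finType) (w : {perm T}) x y :
  (w x \in porbit w y) = (x \in porbit w y).
Proof. by rewrite -!eq_porbit_mem -[w x]/((w ^+ 1)%g x) porbit_perm. Qed.

Lemma porbit_norm (T : finType) (w : {perm T}) x :
  w \in 'N(porbit w x | 'P)%g.
Proof. by apply/norm_setP=> y; exact: porbit_step. Qed.

Lemma porbit_eq_in (T : finType) (w w' : {perm T}) x :
  {in porbit w x, w' =1 w} -> porbit w' x = porbit w x.
Proof.
move=> eww'; have e i : (w' ^+ i)%g x = (w ^+ i)%g x.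
  by elim: i => [|i IHi]; rewrite ?perm1 // !expgSr !permM IHi eww' ?mem_porbit.
by apply/setP=> y; apply/porbitP/porbitP=> -[i ->]; exists i.
Qed.

Lemma norm_porbit_sub (T : finType) (S : {set T}) (w : {perm T}) x :
  w \in 'N(S | 'P)%g -> x \in S -> porbit w x \subset S.
Proof. by move/norm_setP=> Sw; apply: porbit_sub => z; rewrite Sw. Qed.

Lemma porbit_fixed (T : finType) (w : {perm T}) x :
  w x = x -> porbit w x = [set x].
Proof.
move=> wx; apply/eqP; rewrite eqEsubset sub1set porbit_id porbit_sub ?set11 //.
by move=> z /set1P ->; rewrite wx set11.
Qed.

(** The transposition glues the two cycles: [porbits_mul_tperm], used for [w] and
    for the product, forces [x] and [y] into one cycle of the product. *)
Lemma porbit_merge (T : finType) (w : {perm T}) x y :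
  y \notin porbit w x ->
  porbit (tperm x y * w)%g x = porbit w x :|: porbit w y.
Proof.
move=> xy; set w' := (tperm x y * w)%g.
have ww' z : w z = w' (tperm x y z) by rewrite permM tpermK.
have neq_xy : x != y by apply: contraNneq xy => <-; exact: porbit_id.
have y_w' : y \in porbit w' x.
  have := porbits_mul_tperm w x y; have := porbits_mul_tperm w' x y.
  rewrite /= /w' mulgA tperm2 mul1g -/w' neq_xy porbit_sym [x \in porbit w y]porbit_sym.
  by rewrite xy; case: (y \in porbit w' x) => //=; lia.
have stab z : z \in porbit w' x -> w z \in porbit w' x.
  by rewrite ww' porbit_step; case: tpermP => // _ _; exact: porbit_id.
apply/eqP; rewrite eqEsubset subUset !porbit_sub ?porbit_id ?inE ?porbit_id //.
by move=> z; rewrite !inE /w' permM; case: tpermP => [->|->|_ _];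
  rewrite !porbit_step ?porbit_id ?orbT.
Qed.

Lemma porbit_merge_out (T : finType) (w : {perm T}) x y z :
  z \notin porbit w x -> z \notin porbit w y ->
  porbit (tperm x y * w)%g z = porbit w z.
Proof.
move=> zx zy; apply: porbit_eq_in => t tz; rewrite permM tpermD //.
  by apply: contraNneq zx => ->; rewrite porbit_sym.
by apply: contraNneq zy => ->; rewrite porbit_sym.
Qed.

(** A stable set is a disjoint union of cycles. *)
Lemma dvdn_card_stable (T : finType) (d : nat) (w : {perm T}) (A : {set T}) :
  w \in 'N(A | 'P)%g -> {in A, forall x, d %| #|porbit w x|}%N -> (d %| #|A|)%N.
Proof.
elim: {A}_.+1 {-2}A (ltnSn #|A|) => // n IHn A leAn Aw dA.
have [->|[x Ax]] := set_0Vmem A; first by rewrite cards0 dvdn0.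
have sxA := norm_porbit_sub Aw Ax.
rewrite -(cardsID (porbit w x) A) (setIidPr sxA) dvdn_add ?dA //.
apply: IHn => [|| y]; last by rewrite inE => /andP[_ /dA].
  move: leAn; rewrite -(cardsID (porbit w x) A) (setIidPr sxA).
  by have:= card_porbit_neq0 w x; lia.
by apply/norm_setP=> y; rewrite !inE porbit_step (norm_setP _ _ Aw).
Qed.

(** * Rooted sums *)

(** The point [s] is the root.  For [d = 0] every point of [A] must lie on its cycle,
    since cycle lengths are positive and 0 divides only 0. *)
Definition off_root_dvd (T : finType) (d : nat) (A : {set T}) (w : {perm T}) s :=
  [forall x in A :\: porbit w s, (d %| #|porbit w x|)%N].

(** When [d] divides the size of a stable set, the length of the root's cycle is
    a difference of two multiples of [d], so only the other cycles matter. *)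
Lemma all_dvd_off_root (T : finType) (d : nat) (A : {set T}) (w : {perm T}) s :
  w \in 'N(A | 'P)%g -> s \in A ->
  [forall x in A, (d %| #|porbit w x|)%N] = (d %| #|A|)%N && off_root_dvd d A w s.
Proof.
move=> Aw As; apply/forall_inP/andP=> [dA | [dA /forall_inP dAs] x Ax].
  split; first exact: dvdn_card_stable Aw dA.
  by apply/forall_inP=> x /setDP[/dA].
have [xs|xs] := boolP (x \in porbit w s); last by rewrite dAs // inE xs.
have /eqP -> : porbit w x == porbit w s by rewrite eq_porbit_mem.
move: dA; rewrite -(cardsID (porbit w s) A).
rewrite (setIidPr (norm_porbit_sub Aw As)) dvdn_addl //.
apply: (@dvdn_card_stable _ _ w) => //.
by apply/norm_setP=> y; rewrite !inE porbit_step (norm_setP _ _ Aw).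
Qed.

Lemma perm_on_norm (T : finType) (S : {set T}) (u : {perm T}) :
  perm_on S u -> u \in 'N(S | 'P)%g.
Proof. by move=> Su; apply/norm_setP=> x; rewrite perm_closed. Qed.

(** The flag [e] selects the signed sum.  With [d = 0] the sum runs over the
    permutations that are a single cycle on [S]. *)
Definition rooted_sum (T : finType) (d : nat) (e : bool) (S : {set T}) s : rat :=
  \sum_(u : {perm T} | perm_on S u && off_root_dvd d S u s)
    (-1) ^+ (e && odd_perm u).

Lemma off_root_merge (T : finType) (d : nat) (A : {set T}) (w : {perm T}) x y :
  y \notin porbit w x ->
  off_root_dvd d A (tperm x y * w)%g x =
  [forall z in A :\: (porbit w x :|: porbit w y), (d %| #|porbit w z|)%N].
Proof.
move=> xy; rewrite /off_root_dvd porbit_merge //; apply: eq_forallb_in => z.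
by rewrite !inE negb_or => /andP[/andP[zx zy] _]; rewrite porbit_merge_out.
Qed.

Lemma perm_on_tperm_mul (T : finType) (S : {set T}) (u : {perm T}) s x :
  s \in S -> x \in S -> perm_on (S :\ s) u -> perm_on S (tperm s x * u)%g.
Proof.
move=> Ss Sx Su; apply: perm_onM; last first.
  by apply: subset_trans Su _; rewrite subD1set.
by apply/subsetP=> z; rewrite inE; case: tpermP => [->|->|]; rewrite ?Ss ?Sx ?eqxx.
Qed.

(** Write a permutation of [S] as [tperm s x * u] with [u] fixing the root [s] and
    [x] the point sent to [s].  If [x] differs from [s], then [u] is rooted at [x]
    and its sign is opposite.  If [x = s], the cycle of [s] is trivial and all
    cycles of [u] on [S :\ s] are constrained, which requires [d] to divide
    their total size. *)
Lemma rooted_sum_rec (T : finType) (d : nat) (e : bool) (S : {set T}) s :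
  s \in S -> (1 < #|S|)%N ->
  exists2 t, t \in S :\ s &
  rooted_sum d e S s =
  \sum_(x in S :\ s) (-1) ^+ e * rooted_sum d e (S :\ s) x
  + (d %| #|S|.-1)%:R * rooted_sum d e (S :\ s) t.
Proof.
move=> Ss S_gt1; have cS : #|S :\ s| = #|S|.-1 by rewrite (cardsD1 s S) Ss.
have [S0|[t St]] := set_0Vmem (S :\ s).
  by move: S_gt1 cS; rewrite S0 cards0; case: #|S| => [|[]].
exists t => //; rewrite /rooted_sum.
pose F (u : {perm T}) : rat := (-1) ^+ (e && odd_perm u).
rewrite (partition_big (fun u : {perm T} => (u^-1)%g s) (mem S)) /=; last first.
  by move=> u /andP[Su _]; rewrite -(perm_closed _ Su) permKV.
have split_x x : x \in S ->
  \sum_(u | perm_on S u && off_root_dvd d S u s && ((u^-1)%g s == x)) F u =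
  \sum_(u | perm_on (S :\ s) u && off_root_dvd d S (tperm s x * u)%g s)
     F (tperm s x * u)%g.
  move=> Sx; rewrite (reindex_inj (mulgI (tperm s x))); apply: eq_bigl => u.
  rewrite invMg permM tpermV.
  have -> : (tperm s x ((u^-1)%g s) == x) = ((u^-1)%g s == s).
    by rewrite -(inj_eq (@perm_inj _ (tperm s x))) tpermK tpermR.
  rewrite andbAC; congr (_ && _); apply/andP/idP => [[Su /eqP us]|Su].
    apply/subsetP=> z; rewrite !inE => uz.
    have zs : z != s by apply: contraNneq uz => ->; rewrite -{1}us permKV.
    rewrite zs /=; have [->//|zx] := eqVneq z x.
    apply: (subsetP Su); rewrite inE permM tpermD //; by rewrite eq_sym.
  rewrite perm_on_tperm_mul //; split=> //; apply/eqP.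
  by apply: (@perm_inj _ u); rewrite permKV (out_perm Su) ?inE ?eqxx.
rewrite (eq_bigr _ split_x) (bigD1 s) //= addrC; congr (_ + _).
  apply: eq_big => [x|x /andP[Sx xs]]; first by rewrite in_setD1 andbC.
  rewrite mulr_sumr; apply: eq_big => [u|u _]; last first.
    rewrite /F odd_mul_tperm eq_sym xs /=; clear F split_x.
    by case: e; case: (odd_perm u) => /=; ring.
  apply: andb_id2l => Su.
  have us : porbit u s = [set s] by rewrite porbit_fixed // (out_perm Su) // !inE eqxx.
  by rewrite off_root_merge us ?inE // -setDDl.
rewrite mulr_sumr big_mkcondr [RHS]big_mkcondr tperm1; apply: eq_bigr => u Su.
have us : porbit u s = [set s] by rewrite porbit_fixed // (out_perm Su) // !inE eqxx.
rewrite mul1g {1}/off_root_dvd us (all_dvd_off_root _ (perm_on_norm Su) St) cS.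
by case: dvdn => /=; rewrite ?mul1r // mul0r if_same.
Qed.

(** The solution of the recursion [rooted_sum_rec]: the root drops out and only the
    size of the set remains. *)
Definition rooted_prod (d : nat) (e : bool) (n : nat) : rat :=
  \prod_(1 <= j < n) ((-1) ^+ e * j%:R + (d %| j)%:R).

Lemma rooted_sumE (T : finType) (d : nat) (e : bool) (S : {set T}) s :
  s \in S ->
  rooted_sum d e S s = rooted_prod d e #|S|.
Proof.
rewrite /rooted_prod => Ss; move: {2}(#|S|) (erefl #|S|) => n.
elim: n S s Ss => [|n IHn] S s Ss cS.
  by move: Ss; rewrite (cards0_eq cS) inE.
have cS1 : #|S :\ s| = n by move: cS; rewrite (cardsD1 s S) Ss => -[].
have [n0 | n_gt0] := posnP n.
  move: cS; rewrite n0 => cS; rewrite cS big_geq //.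
  have {Ss cS} -> : S = [set s].
    by apply/esym/eqP; rewrite eqEcard sub1set Ss cards1 cS.
  rewrite /rooted_sum (big_pred1 1%g) ?odd_perm1 ?andbF // => u /=.
  apply/andP/eqP=> [[su _]|->]; last first.
    split; first exact: perm_on1.
    by apply/forall_inP=> x; rewrite !inE => /andP[+ /eqP xs]; rewrite xs porbit_id.
  apply/permP=> x; rewrite perm1; have [->|xs] := eqVneq x s.
    by have:= perm_closed s su; rewrite !inE eqxx => /eqP.
  by rewrite (out_perm su) ?inE.
have [|t St ->] := rooted_sum_rec d e Ss; first by rewrite cS.
rewrite cS /= big_nat_recr //= -cS1.
under eq_bigr => x Sx do rewrite IHn //.
by rewrite IHn // sumr_const cS1 -mulr_natl; ring.
Qed.

(** * Signs on stable sets *)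

(** Parity is read off from the number of cycles: [S] together with one fixed point
    for each element outside [S]. *)
Lemma odd_single_porbit (T : finType) (S : {set T}) (u : {perm T}) s :
  perm_on S u -> porbit u s = S -> odd_perm u = ~~ odd #|S|.
Proof.
move=> Su uS.
have porbit1 x : x \in ~: S -> porbit u x = [set x].
  by rewrite inE => Sx; rewrite porbit_fixed ?(out_perm Su).
have cu : porbits u = S |: [set [set x] | x in ~: S].
  apply/setP=> A; rewrite !inE; apply/imsetP/orP=> [[x _ ->]|].
    have [Sx|Sx] := boolP (x \in S).
      by left; rewrite -uS eq_porbit_mem uS.
    by right; rewrite porbit1 ?inE // imset_f ?inE.
  case=> [/eqP->|/imsetP[x Sx ->]]; first by exists s.
  by exists x; rewrite // porbit1.
rewrite /odd_perm cu cardsU1 card_imset; last exact: set1_inj.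
have -> : S \notin [set [set x] | x in ~: S].
  by apply/imsetP=> -[x + Sx1]; rewrite Sx1 !inE eqxx.
by rewrite -(cardsC S) !oddD; case: (odd #|S|); case: (odd #|~: S|).
Qed.

Lemma restr_permM (T : finType) (S : {set T}) (u v : {perm T}) :
  u \in 'N(S | 'P)%g -> v \in 'N(S | 'P)%g ->
  restr_perm S (u * v)%g = (restr_perm S u * restr_perm S v)%g.
Proof. by move=> Su Sv; rewrite morphM. Qed.

Lemma restr_perm_id (T : finType) (S : {set T}) (u : {perm T}) :
  perm_on S u -> restr_perm S u = u.
Proof.
move=> Su; apply/permP=> x; have [Sx|Sx] := boolP (x \in S).
  by rewrite restr_permE ?perm_on_norm.
by rewrite (out_perm Su) // (out_perm (restr_perm_on S u)).
Qed.

Lemma restr_perm_out (T : finType) (S : {set T}) (u : {perm T}) :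
  perm_on (~: S) u -> restr_perm S u = 1%g.
Proof.
move=> Su; apply/permP=> x; have [Sx|Sx] := boolP (x \in S).
  have Nu : u \in 'N(S | 'P)%g by rewrite -astabsC perm_on_norm.
  by rewrite restr_permE // perm1 (out_perm Su) // inE Sx.
by rewrite perm1 (out_perm (restr_perm_on S u)).
Qed.

Lemma porbit_restr (T : finType) (S : {set T}) (w : {perm T}) x :
  w \in 'N(S | 'P)%g -> x \in S -> porbit (restr_perm S w) x = porbit w x.
Proof.
move=> Sw Sx; apply: porbit_eq_in => y xy; rewrite restr_permE //.
exact: subsetP (norm_porbit_sub Sw Sx) y xy.
Qed.

Lemma odd_restr_porbit (T : finType) (w : {perm T}) x :
  odd_perm (restr_perm (porbit w x) w) = ~~ odd #|porbit w x|.
Proof.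
apply: (@odd_single_porbit _ _ _ x); first exact: restr_perm_on.
by rewrite porbit_restr ?porbit_id ?porbit_norm.
Qed.

Lemma norm_setU (T : finType) (A B : {set T}) (w : {perm T}) :
  w \in 'N(A | 'P)%g -> w \in 'N(B | 'P)%g -> w \in 'N(A :|: B | 'P)%g.
Proof. by move=> /norm_setP Aw /norm_setP Bw; apply/norm_setP=> x; rewrite !inE Aw Bw. Qed.

Lemma restr_permU (T : finType) (A B : {set T}) (w : {perm T}) :
  w \in 'N(A | 'P)%g -> w \in 'N(B | 'P)%g -> [disjoint A & B] ->
  restr_perm (A :|: B) w = (restr_perm A w * restr_perm B w)%g.
Proof.
move=> Aw Bw dAB; have ABw := norm_setU Aw Bw.
apply/permP=> x; rewrite permM; have [Ax|nAx] := boolP (x \in A).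
  have nB : w x \notin B by rewrite (norm_setP _ _ Bw) (disjointFr dAB).
  have ABx : x \in A :|: B by rewrite inE Ax.
  by rewrite (restr_permE ABw ABx) (restr_permE Aw Ax) (out_perm (restr_perm_on _ _)).
rewrite [restr_perm A w x](out_perm (restr_perm_on _ _)) //.
have [Bx|nBx] := boolP (x \in B); last first.
  by rewrite !(out_perm (restr_perm_on _ _)) // inE negb_or nAx.
have ABx : x \in A :|: B by rewrite inE Bx orbT.
by rewrite (restr_permE ABw ABx) (restr_permE Bw Bx).
Qed.

(** Meaningful for [w] stabilizing [S]; [restr_perm] is trivial otherwise. *)
Definition stable_sign (T : finType) (S : {set T}) (w : {perm T}) : rat :=
  (-1) ^+ odd_perm (restr_perm S w).

Lemma stable_signM (T : finType) (S : {set T}) (u v : {perm T}) :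
  u \in 'N(S | 'P)%g -> v \in 'N(S | 'P)%g ->
  stable_sign S (u * v)%g = stable_sign S u * stable_sign S v.
Proof.
by move=> Su Sv; rewrite /stable_sign restr_permM // odd_permM signr_addb.
Qed.

Lemma stable_signV (T : finType) (S : {set T}) (u : {perm T}) :
  u \in 'N(S | 'P)%g -> stable_sign S u^-1%g = stable_sign S u.
Proof. by move=> Su; rewrite /stable_sign morphV // odd_permV. Qed.

(** Each term is -1 to the number of cycles inside [S].  If [w] has a cycle [O] missing [p], then
    [S] and [S :|: O], for [S] disjoint from [O], cancel.  If there is none, only
    the empty set contributes. *)
Lemma sum_stable_subsets (T : finType) (w : {perm T}) p :
  \sum_(S : {set T} | (p \notin S) && (w \in 'N(S | 'P)%g))
     (-1) ^+ #|S| * stable_sign S w = (porbit w p == setT)%:R.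
Proof.
have [wp|wp] := eqVneq (porbit w p) setT.
  rewrite (big_pred1 set0) /= => [|S].
    rewrite cards0 expr0 mul1r /stable_sign restr_perm_out ?odd_perm1 //.
    by rewrite setC0; apply/subsetP=> x; rewrite inE.
  apply/andP/eqP=> [[pS Sw]|->]; last first.
    by rewrite inE; split=> //; apply/norm_setP=> x; rewrite !inE.
  apply/setP=> x; rewrite inE; apply: contraNF pS => Sx.
  by apply: (subsetP (norm_porbit_sub Sw Sx)); rewrite porbit_sym wp inE.
have [y yp] : exists y, y \notin porbit w p.
  by apply/existsP; rewrite -negb_forall; apply: contra wp => /forallP h;
     apply/eqP/setP=> x; rewrite h inE.
set O := porbit w y; have Ow : w \in 'N(O | 'P)%g := porbit_norm w y.
have pO : p \notin O by rewrite porbit_sym.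
rewrite (bigID (fun S : {set T} => y \in S)) /=.
rewrite (reindex_onto (fun S => S :|: O) (fun S => S :\: O)) /=; last first.
  move=> S /andP[/andP[pS Sw] Sy].
  by rewrite setDE setUIl [~: O :|: O]setUC setUCr setIT (setUidPl (norm_porbit_sub Sw Sy)).
set P := (X in \sum_(i | X i) _ + _).
set Q := (X in _ + \sum_(i | X i) _ = _).
have PQ : P =1 Q.
  move=> S; rewrite /P /Q !in_setU porbit_id orbT andbT negb_or pO andbT -!andbA.
  congr (_ && _); apply/andP/andP=> [[SOw /eqP eS]|[Sw Sy]].
    have eSD : S = S :\: O by rewrite -{1}eS setDUl setDv setU0.
    split; last by rewrite eSD inE porbit_id.
    rewrite -eS; apply/norm_setP=> x.
    by rewrite [LHS]in_setD porbit_step (norm_setP _ _ SOw) [RHS]in_setD.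
  have dSO : [disjoint O & S].
    rewrite disjoints_subset; apply: norm_porbit_sub; last by rewrite inE.
    by rewrite astabsC.
  split; first exact: norm_setU.
  by rewrite setDUl setDv setU0; apply/eqP/setDidPl; rewrite disjoint_sym.
rewrite (eq_bigl _ _ PQ) -big_split big1 // => S /= /andP[/andP[pS Sw] Sy].
have dSO : [disjoint S & O].
  rewrite disjoint_sym disjoints_subset; apply: norm_porbit_sub; last by rewrite inE.
  by rewrite astabsC.
have -> : #|S :|: O| = (#|S| + #|O|)%N by apply/eqP; rewrite (leq_card_setU S O).2.
rewrite /stable_sign restr_permU // odd_permM signr_addb odd_restr_porbit exprD.
rewrite -[(-1) ^+ #|O|]signr_odd.
move: (_ ^+ #|S|) (_ ^+ restr_perm S w) => a b.
by case: (odd #|O|) => /=; ring.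
Qed.

(** A permutation stabilizing [S] is a pair of permutations of [S] and its
    complement.  The transposition only glues the cycle of [s] to that of [t], so
    the condition away from the glued cycle splits over the two factors. *)
Lemma sum_stable_merge (T : finType) (d : nat) (S : {set T}) s t :
  s \in S -> t \notin S ->
  \sum_(w : {perm T} | (w \in 'N(S | 'P)%g) &&
      off_root_dvd d setT (tperm s t * w)%g s) stable_sign S w =
  rooted_sum d true S s * rooted_sum d false (~: S) t.
Proof.
move=> Ss St; rewrite /rooted_sum big_distrlr /= pair_big /=.
rewrite (reindex_onto (fun uv : {perm T} * {perm T} => (uv.1 * uv.2)%g)
   (fun w => (restr_perm S w, restr_perm (~: S) w))) /=; last first.
  move=> w /andP[Sw _]; rewrite -restr_permU ?astabsC //; last first.
    by rewrite disjoints_subset setCK.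
  by rewrite setUCr restr_perm_id //; apply/subsetP=> x; rewrite inE.
rewrite [LHS]big_mkcond [RHS]big_mkcond; apply: eq_bigr => -[u v] _ /=.
have [Su|Su] /= := boolP (perm_on S u); last first.
  rewrite ifF //; apply: contraNF Su => /andP[_ /eqP[<- _]]; exact: restr_perm_on.
have [Sv|Sv] /= := boolP (perm_on (~: S) v); last first.
  rewrite andbF ifF //; apply: contraNF Sv => /andP[_ /eqP[_ <-]]; exact: restr_perm_on.
have Nu := perm_on_norm Su; have Nv : v \in 'N(S | 'P)%g by rewrite -astabsC perm_on_norm.
have Nuv : (u * v)%g \in 'N(S | 'P)%g by rewrite groupM.
have eu : restr_perm S (u * v)%g = u.
  by rewrite restr_permM // restr_perm_id // restr_perm_out // mulg1.
have ev : restr_perm (~: S) (u * v)%g = v.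
  by rewrite restr_permM ?astabsC // restr_perm_out ?setCK // restr_perm_id // mul1g.
rewrite Nuv eu ev eqxx andbT /= /stable_sign eu expr0 mulr1; congr (if _ then _ else _).
set w := (u * v)%g in Nuv eu ev *.
have ou x : x \in S -> porbit u x = porbit w x by move=> Sx; rewrite -{1}eu porbit_restr.
have ov x : x \in ~: S -> porbit v x = porbit w x.
  by move=> Sx; rewrite -{1}ev porbit_restr ?astabsC.
have tC : t \in ~: S by rewrite inE.
have sS := norm_porbit_sub Nuv Ss.
have tS : porbit w t \subset ~: S by rewrite norm_porbit_sub ?astabsC.
have tws : t \notin porbit w s by apply: contra St; apply: subsetP sS t.
rewrite off_root_merge //; apply/forall_inP/andP=> [dw|[/forall_inP du /forall_inP dv] x].
  split; apply/forall_inP=> x /setDP[Sx].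
    rewrite ou // ou // => xs; apply: dw; rewrite !inE negb_or xs andbT.
    by apply: contraL Sx => /(subsetP tS); rewrite inE.
  rewrite ov // ov // => xs; apply: dw; rewrite !inE negb_or xs !andbT.
  by apply: contraL Sx => /(subsetP sS); rewrite inE => ->.
rewrite !inE negb_or andbT => /andP[xs xt].
have [Sx|Sx] := boolP (x \in S).
  by rewrite -ou // du // inE Sx andbT ou.
by rewrite -ov ?inE // dv // !inE Sx andbT ov.
Qed.

(** * Counting pairs of long cycles *)

Definition is_cycle (T : finType) (a : {perm T}) :=
  [forall x, porbit a x == setT].

Definition all_dvd (T : finType) (d : nat) (g : {perm T}) :=
  [forall x, (d %| #|porbit g x|)%N].

Lemma is_cycleE (T : finType) (a : {perm T}) x :
  is_cycle a = (porbit a x == setT).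
Proof.
apply/forallP/eqP=> [/(_ x)/eqP // | ax y].
by rewrite -ax eq_porbit_mem ax inE.
Qed.

(** This brings the count of N-cycles under the same rooted sums, with [d = 0]. *)
Lemma is_cycle_off_root (T : finType) (a : {perm T}) x :
  is_cycle a = off_root_dvd 0 setT a x.
Proof.
rewrite (is_cycleE _ x); apply/eqP/forall_inP=> [-> y | ax].
  by rewrite setDv inE.
apply/setP=> y; rewrite [RHS]inE; apply/negPn/negP=> yx.
have := ax y; rewrite !inE yx dvd0n (negPf (card_porbit_neq0 _ _)).
by move/(_ isT).
Qed.

Lemma all_dvd_off_rootT (T : finType) (d : nat) (g : {perm T}) x :
  (d %| #|T|)%N -> all_dvd d g = off_root_dvd d setT g x.
Proof.
move=> dT; have gT : g \in 'N([set: T] | 'P)%g.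
  by apply/norm_setP=> y; rewrite !inE.
have := all_dvd_off_root d gT (in_setT x); rewrite cardsT dT /= => <-.
by apply: eq_forallb => y; rewrite inE.
Qed.

Lemma porbitJ (T : finType) (a t : {perm T}) x :
  porbit (a ^ t)%g (t x) = t @: porbit a x.
Proof.
apply/setP=> y; apply/porbitP/imsetP=> [[i ->]|[z /porbitP[i ->] ->]].
  by exists ((a ^+ i)%g x); rewrite ?mem_porbit // -conjXg permJ.
by exists i; rewrite -conjXg permJ.
Qed.

Lemma is_cycleJ (T : finType) (a t : {perm T}) : is_cycle (a ^ t)%g = is_cycle a.
Proof.
have sub b u : is_cycle b -> is_cycle (b ^ u)%g.
  move=> /forallP bT; apply/forallP=> x.
  rewrite -[x](permKV u) porbitJ (eqP (bT _)).
  by apply/eqP/setP=> y; rewrite inE -[y](permKV u) imset_f ?inE.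
apply/idP/idP=> [aT|]; last exact: sub.
by rewrite -(conjgK t a); exact: sub.
Qed.

Lemma tperm_in_norm (T : finType) (S : {set T}) x y :
  (x \in S) = (y \in S) -> tperm x y \in 'N(S | 'P)%g.
Proof. by move=> xy; apply/norm_setP=> z; case: tpermP => [->|->|]. Qed.

(** Conjugating [a] by [t = tperm s1 s2] multiplies [a^-1 * g] by [t] on the left
    and by [t ^ g] on the right.  The first is a transposition inside [S], the
    second moves only points outside [S], so the sign on [S] is reversed. *)
Lemma cancel_two_exits (T : finType) (S : {set T}) (g : {perm T}) s1 s2 :
  s1 != s2 -> s1 \in S -> s2 \in S -> g s1 \notin S -> g s2 \notin S ->
  \sum_(a : {perm T} | is_cycle a && ((a^-1 * g)%g \in 'N(S | 'P)%g))
     stable_sign S (a^-1 * g)%g = 0.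
Proof.
move=> s12 S1 S2 g1 g2; set X := (LHS).
suff : X = - X by lra.
(* Here [t'] is [t ^ g]: it moves the images of [s1] and [s2], both outside [S]. *)
pose t := tperm s1 s2; pose t' := tperm (g s1) (g s2).
have tN : t \in 'N(S | 'P)%g by apply: tperm_in_norm; rewrite S1 S2.
have t'N : t' \in 'N(S | 'P)%g.
  by apply: tperm_in_norm; rewrite (negPf g1) (negPf g2).
have conjE (a : {perm T}) : ((a ^ t)^-1 * g = t * (a^-1 * g) * t')%g.
  by rewrite /t' -tpermJ -/t -conjVg !conjgE tpermV !mulgA mulgK.
rewrite {1}/X (reindex_inj (conjg_inj t)) /= -sumrN; apply: eq_big => a.
  by rewrite is_cycleJ conjE groupMr // groupMl.
rewrite is_cycleJ conjE groupMr // groupMl // => /andP[_ aN].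
rewrite (stable_signM (groupM tN aN) t'N) (stable_signM tN aN).
have -> : stable_sign S t = -1.
  rewrite /stable_sign restr_perm_id ?odd_tperm ?s12 //.
  by apply/subsetP=> z; rewrite inE; case: tpermP => [->|->|]; rewrite ?eqxx.
have -> : stable_sign S t' = 1.
  rewrite /stable_sign restr_perm_out ?odd_perm1 //.
  apply/subsetP=> z; rewrite !inE; case: tpermP => [->|->|] //; by rewrite ?eqxx.
by rewrite mulN1r mulr1.
Qed.

(** [S] and its preimage have the same size, so if one point leaves [S] under [g],
    then exactly one point enters, and this pair is the only one that qualifies. *)
Lemma count_exit_entry (T : finType) (S : {set T}) (g : {perm T}) :
  #|S :\: g @^-1: S| = 1 ->
  \sum_(s in S) \sum_(t in ~: S) (((tperm s t * g)%g \in 'N(S | 'P)%g)%:R : rat) = 1.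
Proof.
set U := g @^-1: S => SU.
have US : #|U :\: S| = 1%N.
  have cU : #|U| = #|S| by rewrite card_preimset //; exact: perm_inj.
  by move: cU; rewrite -(cardsID S U) -(cardsID U S) setIC SU; lia.
have /eqP/cards1P[s0 Es] := SU; have /eqP/cards1P[t0 Et] := US.
have memU x : (g x \in S) = (x \in U) by rewrite inE.
have [Ss0 Us0] : s0 \in S /\ s0 \notin U.
  by apply/andP; rewrite andbC -in_setD Es set11.
have [Ut0 St0] : t0 \in U /\ t0 \notin S.
  by apply/andP; rewrite andbC -in_setD Et set11.
have N_iff s t : s \in S -> t \notin S ->
    ((tperm s t * g)%g \in 'N(S | 'P)%g) = (s == s0) && (t == t0).
  move=> Ss St; apply/norm_setP/andP=> [h|[/eqP-> /eqP->] x].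
    have := h s; rewrite permM tpermL memU Ss => Ut.
    have := h t; rewrite permM tpermR memU (negPf St) => Us.
    by rewrite -!in_set1 -Es -Et !in_setD Ss St Us Ut.
  rewrite permM memU; case: tpermP => [->|->|/eqP xs /eqP xt].
  - by rewrite Ss0 Ut0.
  - by rewrite (negPf Us0) (negPf St0).
  have [Sx|Sx] := boolP (x \in S).
    by apply: contraNT xs => Ux; rewrite -in_set1 -Es in_setD Ux.
  by apply: contraNF xt => Ux; rewrite -in_set1 -Et in_setD Ux Sx.
rewrite (bigD1 s0) //= (bigD1 t0) ?in_setC //= N_iff // !eqxx.
rewrite big1 => [|t /andP[]]; last first.
  by rewrite inE => St tt0; rewrite N_iff // (negPf tt0) andbF.
rewrite big1 ?addr0 // => s /andP[Ss ss0].
by rewrite big1 // => t; rewrite inE => St; rewrite N_iff // (negPf ss0).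
Qed.

Lemma stable_cycle (T : finType) (S : {set T}) (a : {perm T}) p :
  is_cycle a -> a \in 'N(S | 'P)%g -> p \notin S -> S = set0.
Proof.
move=> /forallP aT aS pS; apply/setP=> x; rewrite in_set0; apply: contraNF pS => Sx.
by apply: (subsetP (norm_porbit_sub aS Sx)); rewrite (eqP (aT x)) inE.
Qed.

(** By [count_exit_entry] the right-hand side repeats the left-hand side once when
    a single point leaves [S] under [g].  With two or more such points both sides
    vanish by [cancel_two_exits].  With none, [a] itself would stabilize the proper
    nonempty set [S], which an N-cycle cannot do, and both sides are zero. *)
Lemma localize_exit_entry (T : finType) (S : {set T}) (g : {perm T}) p :
  p \notin S -> S != set0 ->
  \sum_(a : {perm T} | is_cycle a && ((a^-1 * g)%g \in 'N(S | 'P)%g))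
     stable_sign S (a^-1 * g)%g =
  \sum_(s in S) \sum_(t in ~: S | (tperm s t * g)%g \in 'N(S | 'P)%g)
    \sum_(a : {perm T} | is_cycle a && ((tperm s t * a)%g \in 'N(S | 'P)%g))
     stable_sign S (a^-1 * g)%g.
Proof.
move=> pS S0; set X := (LHS).
have -> : \sum_(s in S) \sum_(t in ~: S | (tperm s t * g)%g \in 'N(S | 'P)%g)
    \sum_(a : {perm T} | is_cycle a && ((tperm s t * a)%g \in 'N(S | 'P)%g))
     stable_sign S (a^-1 * g)%g =
  (\sum_(s in S) \sum_(t in ~: S) ((tperm s t * g)%g \in 'N(S | 'P)%g)%:R) * X.
  rewrite mulr_suml; apply: eq_bigr => s _; rewrite mulr_suml big_mkcondr /=.
  apply: eq_bigr => t _; case: ifP => tg; rewrite ?mul0r // mul1r.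
  apply: eq_bigl => a; congr (_ && _).
  have -> : (a^-1 * g = (tperm s t * a)^-1 * (tperm s t * g))%g.
    by rewrite invMg !mulgA mulgKV.
  by rewrite (groupMr _ tg) groupV.
(* The elements of [S :\: g @^-1: S] are the points of [S] that leave [S] under [g]. *)
case cE : #|S :\: g @^-1: S| => [|[|n]]; last 2 first.
- by rewrite count_exit_entry ?mul1r.
- have /card_gt1P[s1 [s2 [/setDP[S1 g1] /setDP[S2 g2] s12]]] :
    (1 < #|S :\: g @^-1: S|)%N by rewrite cE.
  by rewrite inE in g1; rewrite inE in g2; rewrite /X (cancel_two_exits s12) // mulr0.
suff -> : X = 0 by rewrite mulr0.
rewrite /X big_pred0 // => a; apply/andP=> -[aC agN].
have sSU : S \subset g @^-1: S by rewrite -setD_eq0 -cards_eq0 cE.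
have gS : g \in 'N(S | 'P)%g.
  have /eqP/setP eS : S == g @^-1: S.
    by rewrite eqEcard sSU card_preimset ?leqnn //; exact: perm_inj.
  by apply/norm_setP=> x; rewrite [RHS]eS inE.
move: agN; rewrite groupMr // groupV => aN.
by move/eqP: S0; apply; exact: stable_cycle aC aN pS.
Qed.

Lemma rooted_prod0 (e : bool) (n : nat) :
  (0 < n)%N -> rooted_prod 0 e n = (-1) ^+ (e * n.-1) * n.-1`!%:R.
Proof.
case: n => // n _; rewrite /rooted_prod; elim: n => [|n IHn].
  by rewrite big_geq // muln0 mul1r.
by rewrite big_nat_recr //= IHn factS natrM mulnS exprD addr0 /=; ring.
Qed.

(** The transposition of the exit and entry points cancels in [a^-1 * g], so the sum
    over [a] and [g] splits into two sums evaluated by [sum_stable_merge], with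
    parameters 0 and [d].  There are [#|S| * (#|T| - #|S|)] such transpositions. *)
Lemma stable_pair_sum (T : finType) (d : nat) (S : {set T}) p :
  (d %| #|T|)%N -> p \notin S -> S != set0 ->
  (-1) ^+ #|S| *
  \sum_(a : {perm T} | is_cycle a)
    \sum_(g : {perm T} | all_dvd d g && ((a^-1 * g)%g \in 'N(S | 'P)%g))
      stable_sign S (a^-1 * g)%g =
  - ((#|S|`! * (#|T| - #|S|)`!)%:R *
     (rooted_prod d true #|S| * rooted_prod d false (#|T| - #|S|))).
Proof.
move=> dT pS S0.
have cS_gt0 : (0 < #|S|)%N by rewrite card_gt0.
have cC : #|~: S| = (#|T| - #|S|)%N by rewrite -(cardsC S) addKn.
have cC_gt0 : (0 < #|T| - #|S|)%N by rewrite -cC; apply/card_gt0P; exists p; rewrite inE.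
have -> : \sum_(a : {perm T} | is_cycle a)
    \sum_(g : {perm T} | all_dvd d g && ((a^-1 * g)%g \in 'N(S | 'P)%g))
      stable_sign S (a^-1 * g)%g =
  \sum_(s in S) \sum_(t in ~: S)
    rooted_prod 0 true #|S| * rooted_prod 0 false #|~: S| *
    (rooted_prod d true #|S| * rooted_prod d false #|~: S|).
  rewrite (exchange_big_dep (fun g => all_dvd d g)) /=; last by move=> a g _ /andP[].
  under eq_bigr => g gD.
    under eq_bigl => a do rewrite gD /=.
    rewrite (localize_exit_entry _ pS S0); over.
  rewrite exchange_big; apply: eq_bigr => s Ss /=.
  rewrite (exchange_big_dep (mem (~: S))) /=; last by move=> g t _ /andP[].
  apply: eq_bigr => t tC; have St : t \notin S by rewrite inE in tC.
  rewrite -!(rooted_sumE _ _ Ss) -!(rooted_sumE _ _ tC).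
  rewrite -!sum_stable_merge // big_distrlr /= exchange_big /=.
  rewrite [RHS](reindex_inj (mulgI (tperm s t))) /=.
  apply: eq_big => [a|a /andP[_ aN]].
    by rewrite mulgA tperm2 mul1g andbC -is_cycle_off_root.
  rewrite [RHS](reindex_inj (mulgI (tperm s t))) /=.
  apply: eq_big => [g|g /and3P[_ _ gN]].
    by rewrite mulgA tperm2 mul1g tC andbC -(all_dvd_off_rootT _ _ dT).
  rewrite -[stable_sign S (tperm s t * a)]stable_signV // -stable_signM ?groupV //.
  by rewrite invMg !mulgA mulgKV.
rewrite !sumr_const cC !rooted_prod0 //.
move: (rooted_prod d true _) (rooted_prod d false _) => x y.
move: #|S| (#|T| - #|S|)%N cS_gt0 cC_gt0 {cC} => [//|m] [//|n] _ _ /=.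
rewrite !factS !natrM exprS mul1n mul0n expr0.
rewrite -[(_ *+ n.+1) *+ m.+1]mulr_natr -[_ *+ n.+1]mulr_natr.
have := sqrr_sign rat m; move: ((-1) ^+ m) => e; rewrite expr2 => e2.
move: (m.+1%:R : rat) (n.+1%:R : rat) (m`!%:R : rat) (n`!%:R : rat) => m1 n1 mf nf.
transitivity (- (e * e) * (m1 * mf * (n1 * nf) * (x * y))); first by ring.
by rewrite e2; ring.
Qed.

Lemma sum_by_card (T : finType) (p : T) (G : nat -> rat) :
  \sum_(S : {set T} | p \notin S) G #|S| =
  \sum_(0 <= i < #|T|) 'C(#|T|.-1, i)%:R * G i.
Proof.
have sub_p (S : {set T}) : (p \notin S) = (S \subset [set~ p]).
  by rewrite subsetC sub1set inE.
have lt_S (S : {set T}) : p \notin S -> (#|S| < #|T|)%N.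
  by move=> pS; rewrite -(cardsC S) -[X in (X < _)%N]addn0 ltn_add2l;
     apply/card_gt0P; exists p; rewrite inE.
transitivity (\sum_(S : {set T} | p \notin S) \sum_(i < #|T| | i == #|S| :> nat) G i).
  by apply: eq_bigr => S /lt_S ltS; rewrite (big_pred1 (Ordinal ltS)).
rewrite (exchange_big_dep predT) //= big_mkord; apply: eq_bigr => i _.
rewrite sumr_const mulr_natl -(cardsC1 p) -cards_draws; congr (_ *+ _).
by apply: eq_card => S; rewrite !inE -sub_p eq_sym.
Qed.

Lemma count_is_cycle (T : finType) (p : T) :
  \sum_(a : {perm T} | is_cycle a) 1 = #|T|.-1`!%:R :> rat.
Proof.
have := rooted_sumE 0 false (in_setT p); rewrite rooted_prod0 cardsT; last first.
  by apply/card_gt0P; exists p.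
rewrite mul0n expr0 mul1r => <-; apply: eq_big => // a.
rewrite -is_cycle_off_root; have -> // : perm_on setT a.
by apply/subsetP=> x; rewrite inE.
Qed.

Lemma count_all_dvd (T : finType) (d : nat) (p : T) :
  (d %| #|T|)%N ->
  \sum_(g : {perm T} | all_dvd d g) 1 = rooted_prod d false #|T|.
Proof.
move=> dT; have := rooted_sumE d false (in_setT p); rewrite cardsT => <-.
apply: eq_big => // g; rewrite -(all_dvd_off_rootT _ _ dT).
have -> // : perm_on setT g.
by apply/subsetP=> x; rewrite inE.
Qed.

(** The empty set gives the first term; the sets of size [i] avoiding [p], whose
    number is a binomial coefficient, give the [i]-th summand. *)
Lemma cycle_pair_count (T : finType) (d : nat) (p : T) :
  (d %| #|T|)%N ->
  \sum_(a : {perm T} | is_cycle a) \sum_(g : {perm T} | all_dvd d g)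
     (is_cycle (a^-1 * g)%g)%:R =
  #|T|.-1`!%:R * (rooted_prod d false #|T| -
    \sum_(1 <= i < #|T|) (#|T| - i)%:R *
       (rooted_prod d true i * rooted_prod d false (#|T| - i))).
Proof.
move=> dT; have T_gt0 : (0 < #|T|)%N by apply/card_gt0P; exists p.
pose G i : rat := if i == 0%N then #|T|.-1`!%:R * rooted_prod d false #|T| else
  - ((i`! * (#|T| - i)`!)%:R * (rooted_prod d true i * rooted_prod d false (#|T| - i))).
transitivity (\sum_(S : {set T} | p \notin S) G #|S|).
  transitivity (\sum_(S : {set T} | p \notin S) (-1) ^+ #|S| *
     \sum_(a : {perm T} | is_cycle a)
    \sum_(g : {perm T} | all_dvd d g && ((a^-1 * g)%g \in 'N(S | 'P)%g))
      stable_sign S (a^-1 * g)%g).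
    under [RHS]eq_bigr => S _ do rewrite mulr_sumr.
    rewrite [RHS]exchange_big; apply: eq_bigr => a aC /=.
    under [RHS]eq_bigr => S _ do rewrite mulr_sumr.
    rewrite (exchange_big_dep (all_dvd d)) /=; last by move=> S g _ /andP[].
    apply: eq_bigr => g gD; rewrite (is_cycleE _ p) -sum_stable_subsets.
    by apply: eq_bigl => S; rewrite gD.
  apply: eq_bigr => S pS; have [->|S0] := eqVneq S set0; last first.
    by rewrite (stable_pair_sum dT pS S0) /G cards_eq0 (negPf S0).
  rewrite /G cards0 eqxx expr0 mul1r -(count_is_cycle p) -(count_all_dvd p dT).
  rewrite big_distrlr /=; apply: eq_bigr => a _; apply: eq_big => [g|g _].
    have -> : (a^-1 * g)%g \in 'N(set0 | 'P)%g; last by rewrite andbT.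
    by apply/norm_setP=> x; rewrite !inE.
  rewrite /stable_sign restr_perm_out ?odd_perm1 ?mul1r //.
  by rewrite setC0; apply/subsetP=> x; rewrite inE.
rewrite sum_by_card big_ltn // bin0 mul1r /G /= mulrBr; congr (_ + _).
rewrite mulr_sumr -sumrN; apply: eq_big_nat => i /andP[i_gt0 iN].
rewrite ifF; last by case: i i_gt0 {iN}.
have le_i : (i <= #|T|.-1)%N by rewrite -ltnS prednK.
rewrite -(bin_fact le_i) !natrM.
have -> : (#|T| - i = (#|T|.-1 - i).+1)%N by rewrite -subSn ?prednK.
rewrite factS natrM; move: (_%:R) (_%:R) (_%:R) (_%:R) => *; ring.
Qed.

(** * Evaluation of the sum *)

(** Coefficient of z^k in (1 - z)^x. *)
Definition bcoef (x : rat) (k : nat) : rat :=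
  (\prod_(0 <= r < k) (r%:R - x)) / k`!%:R.

(** Coefficient of z^(k - 1) in (1 - z)^(x - 1).  The range stops before [k], so
    that the value at 0 is 0, which absorbs the boundary terms below. *)
Definition bsum (x : rat) (k : nat) : rat := \sum_(0 <= j < k) bcoef x j.

Lemma bcoefS x k : k.+1%:R * bcoef x k.+1 = (k%:R - x) * bcoef x k.
Proof.
rewrite /bcoef big_nat_recr //= factS natrM.
have f0 : k`!%:R != 0 :> rat by rewrite pnatr_eq0 -lt0n fact_gt0.
have k0 : k.+1%:R != 0 :> rat by rewrite pnatr_eq0.
move: (k.+1%:R : rat) (k`!%:R : rat) k0 f0 => k1 f k0 f0.
by field; rewrite k0 f0.
Qed.

(** Compare coefficients in z f' = - x z (1 - z)^(x - 1) for f = (1 - z)^x. *)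
Lemma bcoef_bsum x k : k%:R * bcoef x k = - x * bsum x k.
Proof.
elim: k => [|k IHk]; first by rewrite /bsum big_geq // mulr0 mul0r.
by rewrite bcoefS /bsum big_nat_recr //= -/(bsum x k) mulrDr -IHk; ring.
Qed.

Lemma bsumS x k : bsum x k.+1 = bsum x k + bcoef x k.
Proof. by rewrite /bsum big_nat_recr. Qed.

Lemma bsum0 x : bsum x 0 = 0.
Proof. by rewrite /bsum big_geq. Qed.

Lemma bsum_rec x k : k.+1%:R * bsum x k.+2 = (k.+1%:R - x) * bsum x k.+1.
Proof. by rewrite bsumS mulrDr bcoef_bsum; ring. Qed.

(** Only the factors whose index is a multiple of [d] differ from those of a
    factorial; hence the dependence on [i %/ d]. *)
Lemma rooted_prod_bsum (d : nat) (e : bool) (i : nat) : (0 < d)%N ->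
  rooted_prod d e i.+1 =
  (-1) ^+ (e * i) * i`!%:R * bsum (- (-1) ^+ e / d%:R) (i %/ d).+1.
Proof.
move=> d_gt0; have d0 : d%:R != 0 :> rat by rewrite pnatr_eq0 -lt0n.
rewrite /rooted_prod; elim: i => [|i IHi].
  by rewrite big_geq // div0n muln0 bsumS /bsum big_geq // /bcoef big_geq.
rewrite big_nat_recr //= {}IHi factS natrM mulnS exprD.
have [/dvdnP[[//|k] ik]|ndi] := boolP (d %| i.+1)%N; last first.
  have -> : (i.+1 %/ d = i %/ d)%N by rewrite divnS // (negPf ndi).
  by case: e => /=; rewrite ?expr0 ?expr1; ring.
have ek : (i %/ d = k)%N.
  have -> : (i = k * d + d.-1)%N by lia.
  by rewrite divnMDl // divn_small ?addn0 // prednK.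
rewrite ek ik mulnK //.
have H := bsum_rec (- (-1) ^+ e / d%:R) k.
have k0 : k.+1%:R != 0 :> rat by rewrite pnatr_eq0.
have -> : bsum (- (-1) ^+ e / d%:R) k.+2 =
   (k.+1%:R - (- (-1) ^+ e / d%:R)) * bsum (- (-1) ^+ e / d%:R) k.+1 / k.+1%:R.
  by rewrite -H mulrAC mulfV // mul1r.
rewrite natrM; clear H; move: (bsum _ _) (k.+1%:R : rat) (i`!%:R : rat) k0 => b k1 f k0.
by case: e => /=; rewrite ?expr0 ?expr1 /=; field; rewrite d0 k0.
Qed.

Definition alt_fact (N i : nat) : rat := (-1) ^+ i * (i`! * (N - i)`!)%:R.

(** This is 1/C(N, i) + 1/C(N, i+1) = ((N+1)/N) / C(N-1, i), cleared of denominators. *)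
Lemma alt_fact_diff (N i : nat) : (i < N)%N ->
  alt_fact N i - alt_fact N i.+1 = N.+1%:R * alt_fact N.-1 i.
Proof.
move=> iN; rewrite /alt_fact; have [j ->] : exists j, (N = i + j.+1)%N by exists (N - i.+1)%N; lia.
rewrite addKn addnS -addSn addKn /= addKn !factS !natrM exprS.
have -> : (i.+1 + j).+1%:R = i.+1%:R + j.+1%:R :> rat by rewrite -natrD addnS.
by ring.
Qed.

(** After [bsumS] the product of the two [bsum] terms cancels; [bcoef_bsum] turns the
    other two into multiples of the same product, by [k * d] and [(n - k) * d]. *)
Lemma bsum_cross (d n k : nat) (x y : rat) : (0 < d)%N -> (k <= n)%N ->
  x = d%:R^-1 -> y = - d%:R^-1 ->
  bsum x k.+1 * bsum y (n - k) - bsum x k * bsum y (n - k).+1 =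
  (n * d)%:R * (bcoef x k * bcoef y (n - k)).
Proof.
move=> d_gt0 kn -> ->; have d0 : d%:R != 0 :> rat by rewrite pnatr_eq0 -lt0n.
have en : n%:R = k%:R + (n - k)%:R :> rat by rewrite -natrD subnKC.
rewrite !bsumS natrM en.
have Hk := bcoef_bsum d%:R^-1 k; have Hl := bcoef_bsum (- d%:R^-1) (n - k).
have -> : bsum d%:R^-1 k = - d%:R * (k%:R * bcoef d%:R^-1 k) by rewrite Hk; field.
have -> : bsum (- d%:R^-1) (n - k) = d%:R * ((n - k)%:R * bcoef (- d%:R^-1) (n - k)).
  by rewrite Hl; field.
by ring.
Qed.

(** This is the coefficient of z^n in (1 - z)^x (1 - z)^y with x + y = 0; by
    [bsum_cross] the sum telescopes to zero. *)
Lemma sum_bcoef_cross (d n : nat) (x y : rat) : (0 < d)%N -> (0 < n)%N ->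
  x = d%:R^-1 -> y = - d%:R^-1 ->
  \sum_(0 <= k < n.+1) bcoef x k * bcoef y (n - k) = 0.
Proof.
move=> d_gt0 n_gt0 ex ey.
have nd0 : (n * d)%:R != 0 :> rat by rewrite pnatr_eq0 -lt0n muln_gt0 n_gt0.
apply: (mulfI nd0); rewrite mulr0 mulr_sumr.
pose P k := bsum x k * bsum y (n.+1 - k).
transitivity (\sum_(0 <= k < n.+1) (P k.+1 - P k)).
  apply: eq_big_nat => k /andP[_ kn]; rewrite -(@bsum_cross d) //.
  by rewrite /P subSS subSn.
by rewrite telescope_sumr // /P subnn !bsum0 mulr0 mul0r subrr.
Qed.

(** The index [i] is split as [k * d + r].  Inside a block the [bsum] factors are
    constant, except that the second one drops at the last index; the constant part
    telescopes by [alt_fact_diff] and the drop contributes a separate term.  Summing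
    the first parts over [k] by parts brings in [bsum_cross]. *)
Lemma rooted_prod_total (d n : nat) : (0 < d)%N -> (0 < n)%N ->
  let N := (n * d)%N in
  N.+1%:R * (rooted_prod d false N - \sum_(1 <= i < N) (N - i)%:R *
       (rooted_prod d true i * rooted_prod d false (N - i))) =
  \sum_(0 <= k < n.+1)
    alt_fact N (k * d) * (bcoef d%:R^-1 k * bcoef (- d%:R^-1) (n - k)).
Proof.
move=> d_gt0 n_gt0 N; set x := d%:R^-1; set y := - x.
have d0 : d%:R != 0 :> rat by rewrite pnatr_eq0 -lt0n.
have N_gt0 : (0 < N)%N by rewrite muln_gt0 n_gt0.
pose h k := alt_fact N (k * d).
have hN : rooted_prod d false N = h 0%N * (bcoef x 0 * bcoef y n).
  have bx0 : bcoef x 0 = 1 by rewrite /bcoef big_geq // mul1r invr1.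
  rewrite bx0 mul1r /h /alt_fact mul0n subn0 fact0 mul1n expr0 mul1r.
  rewrite -(prednK N_gt0) rooted_prod_bsum // mul0n !expr0 !mul1r mulN1r -/x -/y.
  have -> : (N.-1 %/ d).+1 = n.
    have -> : N.-1 = (n.-1 * d + d.-1)%N by rewrite /N; nia.
    by rewrite divnMDl // divn_small ?addn0 ?prednK.
  have := bcoef_bsum y n; rewrite factS natrM prednK //.
  have -> : N%:R = n%:R * d%:R :> rat by rewrite natrM.
  move: (bcoef _ _) (bsum _ _) => u v; rewrite /y opprK /x => e.
  by rewrite [_ * d%:R]mulrC -!mulrA [X in d%:R * X]mulrCA e; field.
pose y_ i := alt_fact N.-1 i.
(* At the last index the second [bsum] is taken at 0, so [F] vanishes there and the
   sum can be completed to full blocks. *)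
pose F i := y_ i * (bsum x (i %/ d).+1 *
              bsum y (if i == N.-1 then 0%N else ((N - i).-2 %/ d).+1)).
have -> : \sum_(1 <= i < N) (N - i)%:R *
    (rooted_prod d true i * rooted_prod d false (N - i)) = \sum_(0 <= i < N) F i.
  rewrite -[in RHS](prednK N_gt0) big_nat_recr //= {2}/F eqxx bsum0 !mulr0 addr0.
  rewrite big_add1; apply: eq_big_nat => i /andP[_ iN].
  have [j ej] : exists j, (N - i.+1 = j.+1)%N by exists (N - i.+1).-1; lia.
  have ej2 : (N - i = j.+2)%N by lia.
  have ej3 : (N.-1 - i = j.+1)%N by lia.
  rewrite /F ltn_eqF // ej ej2 /= !rooted_prod_bsum // /y_ /alt_fact ej3.
  rewrite mul1n mul0n expr1 !expr0 opprK !mul1r mulN1r -/x -/y factS !natrM.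
  by move: (_ ^+ i) (bsum _ _) (bsum _ _) (i`!%:R) (j`!%:R) => *; ring.
(* [h] is [alt_fact] at the ends of the blocks; the last term comes from the drop of
   the second [bsum] at the last index of the block. *)
have block k : (k < n)%N ->
  N.+1%:R * \sum_(k * d <= i < k.+1 * d) F i =
  bsum x k.+1 * bsum y (n - k) * (h k - h k.+1)
  - N.+1%:R * (h k.+1 * (bcoef x k.+1 * bcoef y (n - k.+1))).
  move=> kn; have [m em] : exists m, (n - k = m.+1)%N by exists (n - k).-1; lia.
  have -> : (n - k.+1 = m)%N by lia.
  have eN : N = ((k + m).+1 * d)%N by rewrite /N; congr (_ * _)%N; lia.
  pose L := (k * d + d.-1)%N.
  have eL : (k.+1 * d = L.+1)%N by rewrite /L -addnS prednK // mulSn addnC.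
  have lt_LN : (L < N)%N by rewrite -eL leq_mul2r kn orbT.
  have div_block i : (k * d <= i < k.+1 * d)%N -> (i %/ d = k)%N.
    by move=> /andP[ki ik]; apply/eqP; rewrite eqn_leq leq_divRL // ki andbT -ltnS ltn_divLR.
  have FL : F L = y_ L * (bsum x k.+1 * bsum y m).
    rewrite /F div_block; last by rewrite eL ltnS leqnn leq_addr.
    congr (_ * (_ * bsum y _)); have [eLN|neLN] := eqVneq L N.-1.
      have : ((k + m).+1 * d = k.+1 * d)%N by rewrite eL -eN eLN prednK.
      by move/eqP; rewrite eqn_pmul2r // => /eqP; lia.
    case: m em eN => [|m] em eN.
      by case/eqP: neLN; move: eL; rewrite eN addn0 => ->.
    have -> : ((N - L).-2 = m * d + d.-1)%N by rewrite eN /L; nia.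
    by rewrite divnMDl // divn_small ?addn0 ?prednK.
  have FE i : (k * d <= i < L)%N -> F i = y_ i * (bsum x k.+1 * bsum y m.+1).
    move=> /andP[ki iL]; rewrite /F div_block; last by rewrite ki eL ltnS ltnW.
    rewrite ltn_eqF; last by rewrite -ltnS prednK // (leq_ltn_trans iL).
    congr (_ * (_ * bsum y _.+1)).
    have [c ec] : exists c, (L = i + c.+1)%N by exists (L - i.+1)%N; lia.
    have -> : ((N - i).-2 = m * d + c)%N by move: eL; rewrite eN; nia.
    by rewrite divnMDl // divn_small ?addn0 //; move: ec; rewrite /L; lia.
  have -> : \sum_(k * d <= i < k.+1 * d) F i =
      bsum x k.+1 * bsum y m.+1 * (\sum_(k * d <= i < k.+1 * d) y_ i)
      - y_ L * bsum x k.+1 * bcoef y m.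
    rewrite eL !big_nat_recr ?leq_addr //= FL (eq_big_nat _ _ FE) -mulr_suml (bsumS y m).
    by ring.
  have sum_y : N.+1%:R * \sum_(k * d <= i < k.+1 * d) y_ i = h k - h k.+1.
    rewrite mulr_sumr (eq_big_nat _ _ (F2 := fun i => - (alt_fact N i.+1 - alt_fact N i))).
      by rewrite sumrN telescope_sumr ?opprB // leq_mul2r leqnSn orbT.
    move=> i /andP[_ ik]; rewrite opprB alt_fact_diff //.
    by apply: leq_trans ik _; rewrite eL.
  have yL : y_ L * bsum x k.+1 = h k.+1 * bcoef x k.+1.
    have hL : h k.+1 = - (k.+1%:R * d%:R) * y_ L.
      rewrite /h /y_ /alt_fact -natrM eL exprS factS.
      have -> : (N - L.+1 = N.-1 - L)%N by lia.
      by rewrite !natrM; move: (_ ^+ L) (L.+1%:R : rat) (L`!%:R) => *; ring.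
    have := bcoef_bsum x k.+1; rewrite hL; move: (k.+1%:R : rat) => k1 e.
    have -> : bsum x k.+1 = - d%:R * (k1 * bcoef x k.+1) by rewrite e /x; field.
    by ring.
  by rewrite em mulrBr mulrCA sum_y yL -(mulrA (h k.+1)).
rewrite mulrBr -{2}[N]/(n * d)%N big_nat_mul mulr_sumr.
rewrite (eq_big_nat _ _ (fun k kn => block k (proj2 (andP kn)))).
pose G k := bcoef x k * bcoef y (n - k).
(* Summation by parts, with no boundary terms because [bsum] vanishes at 0. *)
have abel : \sum_(0 <= k < n) bsum x k.+1 * bsum y (n - k) * (h k - h k.+1) =
    N%:R * \sum_(0 <= k < n.+1) h k * G k.
  have -> : N%:R * \sum_(0 <= k < n.+1) h k * G k =
    \sum_(0 <= k < n.+1) h k * (bsum x k.+1 * bsum y (n - k))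
    - \sum_(0 <= k < n.+1) h k * (bsum x k * bsum y (n - k).+1).
    rewrite mulr_sumr -sumrB; apply: eq_big_nat => k /andP[_ kn].
    by rewrite -mulrBr (@bsum_cross d) // mulrCA.
  rewrite big_nat_recr //= subnn bsum0 !mulr0 addr0.
  rewrite [X in _ = _ - X]big_nat_recl //= bsum0 mul0r mulr0 add0r -sumrB.
  apply: eq_big_nat => k /andP[_ kn].
  have -> : ((n - k.+1).+1 = n - k)%N by lia.
  by ring.
rewrite sumrB abel -mulr_sumr hN.
have -> : \sum_(0 <= k < n) h k.+1 * (bcoef x k.+1 * bcoef y (n - k.+1)) =
    \sum_(0 <= k < n.+1) h k * G k - h 0%N * G 0%N.
  by rewrite [in RHS]big_nat_recl //= addrC addKr.
have -> : bcoef x 0 * bcoef y n = G 0%N by rewrite /G subn0.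
rewrite -natr1 -[RHS]/(\sum_(0 <= k < n.+1) h k * G k).
by move: (h 0%N * G 0%N) (\sum_(0 <= k < n.+1) _) => u v; ring.
Qed.

(** * The probability *)

Lemma mem_long_cycles (N : nat) (a : 'S_N) :
  (0 < N)%N -> (a \in long_cycles N) = is_cycle a.
Proof.
move=> N_gt0; rewrite inE; apply/eqP/forallP=> [aT x | aT].
  by rewrite -in_set1 -aT imset_f.
apply/setP=> A; rewrite inE; apply/imsetP/eqP=> [[x _ ->]|->].
  exact/eqP.
by exists (Ordinal N_gt0); rewrite // (eqP (aT _)).
Qed.

Lemma cycle_lengths_pos_multiples (N d : nat) (g : 'S_N) :
  cycle_lengths_in (pos_multiples d) g = all_dvd d g.
Proof.
apply/forall_inP/forallP=> [h x|h A /imsetP[x _ ->]].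
  have xg : porbit g x \in porbits g by rewrite imset_f.
  by have /andP[] := h _ xg.
by rewrite inE h lt0n card_porbit_neq0.
Qed.

(** The second cycle is replaced by the product of the two as summation variable. *)
Lemma q_cycle_sum (N d : nat) : (0 < N)%N ->
  q N (pos_multiples d) =
  (\sum_(a : 'S_N | is_cycle a) \sum_(g : 'S_N | all_dvd d g)
     (is_cycle (a^-1 * g)%g)%:R) / (N.-1`!%:R * N.-1`!%:R).
Proof.
move=> N_gt0; rewrite /q cardsX natrM.
have cL : #|long_cycles N|%:R = N.-1`!%:R :> rat.
  have := count_is_cycle (Ordinal N_gt0); rewrite card_ord => <-.
  rewrite -sum1_card natr_sum.
  by apply: eq_bigl => a; rewrite mem_long_cycles.
rewrite cL; congr (_ / _); rewrite -sum1_card natr_sum.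
transitivity (\sum_(a : 'S_N | is_cycle a) \sum_(b : 'S_N | is_cycle b && all_dvd d (a * b)%g) (1 : rat)).
  rewrite pair_big_dep; apply: eq_bigl => -[a b].
  by rewrite in_set in_setX /= !mem_long_cycles // cycle_lengths_pos_multiples andbA.
apply: eq_bigr => a _; rewrite [RHS](reindex_inj (mulgI a)) /=.
rewrite big_mkcond [RHS]big_mkcond; apply: eq_bigr => b _.
by rewrite mulKg andbC; case: all_dvd; case: is_cycle.
Qed.

Lemma alt_fact_bin (N i : nat) : (i <= N)%N ->
  alt_fact N i = N`!%:R * ((-1) ^+ i * ('C(N, N - i)%:R)^-1).
Proof.
move=> iN; rewrite /alt_fact bin_sub // -(bin_fact iN) [in RHS]natrM.
have b0 : 'C(N, i)%:R != 0 :> rat by rewrite pnatr_eq0 -lt0n bin_gt0.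
by move: (_ ^+ i) ('C(N, i)%:R) ((_ * _)%:R) b0 => u v w v0; field.
Qed.

Lemma bcoef_inv_pos (d k : nat) :
  bcoef d%:R^-1 k.+1 =
  - d%:R^-1 * (\prod_(1 <= r < k.+1) (r%:R - 1 / d%:R)) / k.+1`!%:R.
Proof.
by rewrite /bcoef big_ltn // sub0r; congr (_ * _ / _); apply: eq_bigr => r _; rewrite mul1r.
Qed.

Lemma bcoef_inv_neg (d l : nat) :
  bcoef (- d%:R^-1) l = (\prod_(0 <= r < l) (r%:R + 1 / d%:R)) / l`!%:R.
Proof.
by rewrite /bcoef; congr (_ / _); apply: eq_bigr => r _; rewrite opprK mul1r.
Qed.

Lemma sum_scaled_pairs (d n : nat) (F : nat -> nat -> rat) : (0 < d)%N ->
  \sum_(kl : 'I_(n * d).+1 * 'I_(n * d).+1 | (d * kl.1 + d * kl.2 == n * d)%N)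
     F kl.1 kl.2 = \sum_(0 <= k < n.+1) F k (n - k)%N.
Proof.
move=> d_gt0; set N := (n * d)%N; have nN : (n <= N)%N by rewrite leq_pmulr.
rewrite -(pair_big_dep predT (fun k l : 'I_N.+1 => (d * k + d * l == N)%N)
   (fun k l : 'I_N.+1 => F k l)) /=.
rewrite (big_nat_widen _ _ N.+1) // big_mkord [RHS]big_mkcond.
apply: eq_bigr => k _; rewrite ltnS; case: leqP => kn.
  have lN : (n - k < N.+1)%N by rewrite ltnS (leq_trans (leq_subr _ _)).
  rewrite (big_pred1 (Ordinal lN)) // => l /=.
  rewrite -mulnDr /N mulnC eqn_pmul2r // -val_eqE /=.
  by rewrite -[RHS](eqn_add2l k) subnKC.
rewrite big_pred0 // => l; rewrite -mulnDr /N mulnC eqn_pmul2r //.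
by rewrite gtn_eqF // (leq_trans kn) ?leq_addr.
Qed.

Theorem mainTheorem3 (d N : nat) (d_gt1 : (1 < d)%N) (N_gt0 : (0 < N)%N)
    (d_dvd_N : (d %| N)%N) :
  q N (pos_multiples d) =
  N%:R / (d%:R * (N%:R + 1)) *
  \sum_(kl : 'I_N.+1 * 'I_N.+1 | (d * kl.1 + d * kl.2 == N)%N)
    let k : nat := kl.1 in
    let l : nat := kl.2 in
    1 / (k`!%:R * l`!%:R) *
    (1 - (-1) ^+ (d * k) * ('C(N, d * l)%:R)^-1) *
    (\prod_(1 <= r < k) (r%:R - 1 / d%:R)) *
    (\prod_(0 <= r' < l) (r'%:R + 1 / d%:R)).
Proof.
have d_gt0 : (0 < d)%N by exact: ltnW.
case/dvdnP: d_dvd_N N_gt0 => n -> {N}; set N := (n * d)%N => N_gt0.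
have n_gt0 : (0 < n)%N by move: N_gt0; rewrite muln_gt0 => /andP[].
pose c k : rat := (-1) ^+ (d * k) * ('C(N, d * (n - k))%:R)^-1.
pose G k := bcoef d%:R^-1 k * bcoef (- d%:R^-1) (n - k).
have d0 : d%:R != 0 :> rat by rewrite pnatr_eq0 -lt0n.
have N10 : N.+1%:R != 0 :> rat by rewrite pnatr_eq0.
have f0 : N.-1`!%:R != 0 :> rat by rewrite pnatr_eq0 -lt0n fact_gt0.
have -> : q N (pos_multiples d) =
    N%:R / N.+1%:R * \sum_(0 <= k < n.+1) c k * G k.
  have dN : (d %| #|'I_N|)%N by rewrite card_ord dvdn_mull.
  rewrite q_cycle_sum // (cycle_pair_count (Ordinal N_gt0) dN) card_ord.
  have := rooted_prod_total d_gt0 n_gt0; rewrite -/N /=.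
  have -> : \sum_(0 <= k < n.+1)
      alt_fact N (k * d) * (bcoef d%:R^-1 k * bcoef (- d%:R^-1) (n - k)) =
    N%:R * N.-1`!%:R * \sum_(0 <= k < n.+1) c k * G k.
    rewrite mulr_sumr; apply: eq_big_nat => k /andP[_ kn].
    have kdN : (k * d <= N)%N by rewrite leq_mul2r -ltnS kn orbT.
    have eN : N%:R * N.-1`!%:R = N`!%:R :> rat.
      by rewrite -natrM -{1}(prednK N_gt0) -factS prednK.
    rewrite (alt_fact_bin kdN) -mulnBl eN /c /G [(d * k)%N]mulnC [(d * (n - k))%N]mulnC.
    by rewrite -!mulrA.
  move: (_ - _) (\sum_(0 <= k < n.+1) _) => u v e.
  have -> : u = N%:R * N.-1`!%:R * v / N.+1%:R by rewrite -e mulrAC mulfV ?mul1r.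
  by move: (N.+1%:R : rat) (N.-1`!%:R : rat) N10 f0 => a b a0 b0; field; rewrite a0 b0.
rewrite (sum_scaled_pairs n (fun k l : nat => 1 / (k`!%:R * l`!%:R) *
    (1 - (-1) ^+ (d * k) * ('C(N, d * l)%:R)^-1) *
    (\prod_(1 <= r < k) (r%:R - 1 / d%:R)) *
    (\prod_(0 <= r' < l) (r'%:R + 1 / d%:R)))) //.
have zero := @sum_bcoef_cross d n _ _ d_gt0 n_gt0 erefl erefl.
(* The [G k] sum to zero and may be subtracted; afterwards the term [k = 0]
   vanishes, and for positive [k] the coefficient contains the product starting
   at 1. *)
have -> : \sum_(0 <= k < n.+1) c k * G k = \sum_(0 <= k < n.+1) (c k - 1) * G k.
  under [RHS]eq_bigr => k _ do rewrite mulrBl mul1r.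
  by rewrite sumrB zero subr0.
rewrite -natr1 in N10 *.
rewrite mulr_sumr mulr_sumr; apply: eq_bigr => k _; rewrite -/(c k) /G.
case: k => [|k].
  have -> : c 0%N = 1 by rewrite /c muln0 subn0 mulnC -/N binn invr1 mulr1.
  by rewrite !subrr !(mul0r, mulr0).
rewrite bcoef_inv_pos bcoef_inv_neg.
have k0 : k.+1`!%:R != 0 :> rat by rewrite pnatr_eq0 -lt0n fact_gt0.
have l0 : (n - k.+1)`!%:R != 0 :> rat by rewrite pnatr_eq0 -lt0n fact_gt0.
move: (\prod_(1 <= r < k.+1) _) (\prod_(0 <= r < _) _) (c _) k0 l0 => u v w.
move: (_`!%:R : rat) (_`!%:R : rat) => a b a0 b0.
by field; rewrite ?a0 ?b0 ?d0 ?N10.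
Qed.
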